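(* For every real $\sigma > 1$ there is no online algorithm for the $\sigma$-interval coloring problem with asymptotic competitive ratio less than $5/3$.
   Context: For a real $\sigma \ge 1$, the $\sigma$-interval coloring problem is: given a sequence of closed real intervals $[l_1,r_1],\ldots,[l_n,r_n]$ with $1 \le r_i-l_i \le \sigma$ for every $i$, find colors $c_1,\ldots,c_n$ such that for all $i\neq j$, $[l_i,r_i]\cap[l_j,r_j]\neq\emptyset$ implies $c_i\neq c_j$, minimizing the number of distinct colors used. In the online setting the intervals are presented one by one, in an arbitrary order (as intervals, i.e. with their endpoints), and a deterministic algorithm must assign a color to each interval immediately and irrevocably when it is presented, without knowledge of later intervals; $\sigma$ is a fixed parameter of the problem. A set (or sequence, with repetitions allowed) of intervals is $\chi$-colorable if its intersection graph can be properly colored (offline) with at most $\chi$ colors. For an online algorithm $A$, $A(\chi)$ denotes the maximum number of colors $A$ uses on any input that is $\chi$-colorable. $A$ has asymptotic competitive ratio $\alpha$ (is $\alpha$-competitive) if $\limsup_{\chi\to\infty} A(\chi)/\chi \le \alpha$. *)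

(* Defs.v *)
From mathcomp Require Import all_boot all_order all_algebra.
From mathcomp Require Import all_classical all_reals all_analysis.

Set Implicit Arguments.
Unset Strict Implicit.
Unset Printing Implicit Defensive.

Import Order.TTheory GRing.Theory Num.Theory.

Local Open Scope classical_set_scope.
Local Open Scope ring_scope.

(* A pair [I : R * R] stands for the closed interval [I.1, I.2]; inputs are
   sequences of pairs, so repeated intervals are allowed. *)

Definition admissible (R : realType) (sigma : R) (I : R * R) : bool :=
  1 <= I.2 - I.1 <= sigma.

Definition meets (R : realType) (I J : R * R) : Prop :=
  `[I.1, I.2] `&` `[J.1, J.2] !=set0.

Definition proper_coloring (R : realType) (C : Type) (s : seq (R * R))
    (c : 'I_(size s) -> C) : Prop :=
  forall i j : 'I_(size s), i <> j ->
    meets (tnth (in_tuple s) i) (tnth (in_tuple s) j) -> c i <> c j.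

Definition colorable (R : realType) (chi : nat) (s : seq (R * R)) : Prop :=
  exists c : 'I_(size s) -> 'I_chi, proper_coloring c.

(* A deterministic online algorithm is a function [A : seq (R * R) -> nat]:
   [A h] is the color given to the last interval of [h] when the intervals
   presented up to and including that one are, in order, those of [h].  Earlier
   colors are determined by the prefixes of [h]. *)
Definition online_coloring (R : realType) (A : seq (R * R) -> nat)
    (s : seq (R * R)) (i : 'I_(size s)) : nat :=
  A (take i.+1 s).

Definition online_algorithm (R : realType) (sigma : R)
    (A : seq (R * R) -> nat) : Prop :=
  forall s : seq (R * R), all (admissible sigma) s ->
    proper_coloring (online_coloring A (s := s)).

Definition colors_used (R : realType) (A : seq (R * R) -> nat)
    (s : seq (R * R)) : nat :=
  size (undup (codom (online_coloring A (s := s)))).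

(* This is +oo when the number of colors on chi-colorable inputs is unbounded,
   and otherwise a maximum, as the set is nonempty (it contains 0). *)
Definition worst_case_colors (R : realType) (sigma : R)
    (A : seq (R * R) -> nat) (chi : nat) : \bar R :=
  ereal_sup [set ((colors_used A s)%:R)%:E | s in
    [set s : seq (R * R) | all (admissible sigma) s /\ colorable chi s]].

(* The term at chi = 0 is a junk value, without influence on the limsup. *)
Definition competitive (R : realType) (sigma : R)
    (A : seq (R * R) -> nat) (alpha : R) : Prop :=
  (limn_esup (fun chi : nat =>
     worst_case_colors sigma A chi * (chi%:R^-1)%:E) <= alpha%:E)%E.

(* Main.v *)
Require Import Defs.
From mathcomp Require Import all_boot all_order all_algebra.
From mathcomp Require Import all_classical all_reals all_analysis.
From mathcomp Require Import zify lra.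

Import Order.TTheory GRing.Theory Num.Theory.

Local Open Scope ring_scope.

(** The bound comes from an adversary that, for every m, forces any online
algorithm to spend 10m colors on an input that is 6m-colorable (lemma
[forcing]).  Since 10m / 6m = 5/3 for infinitely many chi = 6m, the limsup of
the competitive ratios is at least 5/3.

The engine is separation.  An adversary can present many almost equal
intervals, each placed by bisection according to the color that the previous
one received, so that at the end those whose color satisfies a given predicate
P (the front) have their left (or right) ends strictly beyond the ends of the
others.  A later interval can then meet exactly the front of such a clique.
Only ends inside windows of a small width e matter, and all lengths used lie in
[1, 1 + 2e], which is where sigma > 1 is used.

The adversary builds, from left to right on the line,

  left clique | core [0, 1]  ---- gap of length about 1 ----  right clique

and then fills the gap.

- The core consists of m long intervals, which end at 1 + e, and 2m short
  ones, which end at 1: 3m colors.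
- The left clique ends just before 0; its front consists of the intervals whose
  color is not a core color.  It is stopped when the front has 3m elements.  Let
  W be the 6m colors of the core and of this front.
- The right clique starts just after 2 + e; its front consists of the intervals
  colored from B, the 5m colors of W that are not those of the long core
  intervals.  It is stopped when its front has m elements or its back has 5m
  elements.  In the second case B and the back already give 10m colors.
- Otherwise, the linking clique is presented in the gap.  It meets the long core
  intervals and the front of the right clique, so from W it can only take
  6m - m - m = 4m colors: as it may have 5m elements, the adversary can make m
  of them receive colors outside W.  These form its front, and they extend
  further to the left than the others.
- The final clique consists of 3m equal intervals of length just over 1, which
  cover the core and reach the fronts of the left clique and of the linking
  clique, and nothing else.  They need 3m colors different from the 6m colors
  of W and from the m new ones of the linking clique: 10m in all.

The 6m-coloring of the whole input is explicit (lemmas [layout] and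
[layout_compatible]): the final clique has the labels [0, 3m), the front of the
left clique [3m, 6m), its back [0, 3m), the long core intervals and the front of
the right clique [3m, 4m), the back of the right clique the other 5m labels, the
short core intervals [4m, 6m), the front of the linking clique [4m, 5m), and its
back the 4m labels outside [3m, 5m).  *)

Set Implicit Arguments.
Unset Strict Implicit.
Unset Printing Implicit Defensive.

(** * Colored sequences of intervals *)

Definition overlap (R : realType) (I J : R * R) : bool :=
  (I.1 <= J.2) && (J.1 <= I.2).

(** The same relation expresses properness of the online colors and of the
offline labels: both live in the second components of a sequence of pairs. *)
Definition compatible (R : realType) (p q : (R * R) * nat) : bool :=
  overlap p.1 q.1 ==> (p.2 != q.2).

Fixpoint replies (R : realType) (A : seq (R * R) -> nat) (h s : seq (R * R)) :=
  if s is J :: s' then A (rcons h J) :: replies A (rcons h J) s' else [::].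

Definition transcript (R : realType) (A : seq (R * R) -> nat)
    (z : seq ((R * R) * nat)) : Prop :=
  unzip2 z = replies A [::] (unzip1 z).

Lemma overlapC (R : realType) (I J : R * R) : overlap I J = overlap J I.
Proof. by rewrite /overlap andbC. Qed.

Lemma admissible_le (R : realType) (sigma : R) (I : R * R) :
  admissible sigma I -> I.1 <= I.2.
Proof. by case/andP=> lo _; lra. Qed.

Lemma meets_overlap (R : realType) (I J : R * R) :
  I.1 <= I.2 -> J.1 <= J.2 -> Defs.meets I J <-> overlap I J.
Proof.
move=> leI leJ; split=> [[x /= []]|/andP[IJ JI]].
  rewrite !in_itv /= => /andP[Ix xI] /andP[Jx xJ].
  by rewrite /overlap (le_trans Ix xJ) (le_trans Jx xI).
exists (Num.max I.1 J.1); rewrite /= !in_itv /= !le_max !ge_max !lexx leI leJ.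
by rewrite IJ JI orbT.
Qed.

Lemma size_replies (R : realType) (A : seq (R * R) -> nat) h s :
  size (replies A h s) = size s.
Proof. by elim: s h => //= I s IHs h; rewrite IHs. Qed.

Lemma nth_replies (R : realType) (A : seq (R * R) -> nat) h s i :
  (i < size s)%N -> nth 0%N (replies A h s) i = A (h ++ take i.+1 s).
Proof.
elim: s h i => //= I s IHs h [|i] /=; first by rewrite take0 cats1.
by rewrite ltnS => /(IHs (rcons h I)) ->; rewrite cat_rcons.
Qed.

Lemma replies_cat (R : realType) (A : seq (R * R) -> nat) h s t :
  replies A h (s ++ t) = replies A h s ++ replies A (h ++ s) t.
Proof.
by elim: s h => [|I s IHs] h /=; rewrite ?cats0 // IHs cat_rcons.
Qed.

Lemma transcript_cat (R : realType) (A : seq (R * R) -> nat) z y :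
  transcript A z -> unzip2 y = replies A (unzip1 z) (unzip1 y) ->
  transcript A (z ++ y).
Proof.
by rewrite /transcript /unzip1 /unzip2 !map_cat replies_cat => -> ->.
Qed.

Lemma present (R : realType) (A : seq (R * R) -> nat) h s :
  exists y, unzip1 y = s /\ unzip2 y = replies A h (unzip1 y).
Proof.
exists (zip s (replies A h s)).
by rewrite unzip1_zip ?unzip2_zip ?size_replies.
Qed.

Lemma transcript_compatible (R : realType) (sigma : R) A z :
  online_algorithm sigma A -> all (admissible sigma) (unzip1 z) ->
  transcript A z -> pairwise (@compatible R) z.
Proof.
move=> onA adm tz; pose d : (R * R) * nat := ((0, 0), 0%N).
apply/(pairwiseP d) => i j; rewrite !inE => lti ltj ltij.
have sz : size (unzip1 z) = size z by rewrite size_map.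
have [li lj] : (i < size (unzip1 z))%N /\ (j < size (unzip1 z))%N by rewrite sz.
have /negP nij : Ordinal li != Ordinal lj by rewrite neq_ltn ltij.
have nth1 k : (k < size z)%N -> (nth d z k).1 = nth (0, 0) (unzip1 z) k.
  by move=> ltk; rewrite (nth_map d).
have nth2 k : (k < size z)%N -> (nth d z k).2 = A (take k.+1 (unzip1 z)).
  by move=> ltk; rewrite -(@nth_replies _ A [::]) ?sz // -tz (nth_map d).
have le k : (k < size z)%N -> (nth d z k).1.1 <= (nth d z k).1.2.
  move=> ltk; apply: (@admissible_le _ sigma); rewrite nth1 //.
  by apply: (allP adm); rewrite mem_nth ?sz.
apply/implyP => /(proj2 (meets_overlap (le _ lti) (le _ ltj))).
rewrite !nth1 // !nth2 //.
have := onA _ adm (Ordinal li) (Ordinal lj).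
rewrite !(tnth_nth (0, 0)) /= => H /H H'; apply/eqP; apply: H' => e.
by apply: nij; rewrite e.
Qed.

Lemma compatible_colorable (R : realType) (sigma : R) chi
    (z : seq ((R * R) * nat)) :
  all (admissible sigma) (unzip1 z) -> pairwise (@compatible R) z ->
  all (fun p => p.2 < chi)%N z -> colorable chi (unzip1 z).
Proof.
move=> adm cz ltz; pose d : (R * R) * nat := ((0, 0), 0%N).
have sz : size (unzip1 z) = size z by rewrite size_map.
have lab (i : 'I_(size (unzip1 z))) : ((nth d z i).2 < chi)%N.
  by apply: (allP ltz); rewrite mem_nth // -sz.
exists (fun i => Ordinal (lab i)) => i j nij.
have nth1 (k : 'I_(size (unzip1 z))) :
    tnth (in_tuple (unzip1 z)) k = (nth d z k).1.
  by rewrite (tnth_nth (0, 0)) /= (nth_map d) // -sz.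
have le k :
    (tnth (in_tuple (unzip1 z)) k).1 <= (tnth (in_tuple (unzip1 z)) k).2.
  by apply: (@admissible_le _ sigma); apply: (allP adm); rewrite mem_tnth.
move=> /(proj1 (meets_overlap (le _) (le _))); rewrite !nth1 => ov [e].
have key (a b : 'I_(size (unzip1 z))) : (a < b)%N ->
    overlap (nth d z a).1 (nth d z b).1 -> (nth d z a).2 != (nth d z b).2.
  move=> ltab; apply/implyP; apply: (pairwiseP d cz) => //;
    by rewrite inE -sz.
have [ltij|ltji|eij] := ltngtP i j.
- by have := key _ _ ltij ov; rewrite e eqxx.
- by move: ov; rewrite overlapC => /(key _ _ ltji); rewrite e eqxx.
- by apply: nij; apply: val_inj.
Qed.

Lemma colors_used_ge (R : realType) (A : seq (R * R) -> nat) z cs :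
  transcript A z -> uniq cs -> {subset cs <= unzip2 z} ->
  (size cs <= colors_used A (unzip1 z))%N.
Proof.
move=> tz ucs sub; apply: uniq_leq_size => // c /sub; rewrite tz.
case/(nthP 0%N) => i; rewrite size_replies => lti <-.
rewrite mem_undup nth_replies //=.
by apply/codomP; exists (Ordinal lti).
Qed.

Lemma uniq_compatible (R : realType) (z : seq ((R * R) * nat)) :
  uniq (unzip2 z) -> pairwise (@compatible R) z.
Proof.
rewrite uniq_pairwise pairwise_map; apply: sub_pairwise => p q /= npq.
by rewrite /compatible npq implybT.
Qed.

Lemma clique_uniq (R : realType) (z : seq ((R * R) * nat)) :
  pairwise (@compatible R) z -> {in z &, forall p q, overlap p.1 q.1} ->
  uniq (unzip2 z).
Proof.
move=> cz ov; rewrite uniq_pairwise pairwise_map.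
apply: (@sub_in_pairwise _ (mem z)) cz => [p q pz qz /= /implyP|].
  by apply; apply: ov.
exact/allP.
Qed.

Lemma compatible_neq (R : realType) (z y : seq ((R * R) * nat)) p q :
  pairwise (@compatible R) (z ++ y) -> p \in z -> q \in y ->
  overlap p.1 q.1 -> p.2 <> q.2.
Proof.
rewrite pairwise_cat => /and3P[/allrelP zy _ _] pz qy ov.
by apply/eqP; move: ov; apply/implyP/zy.
Qed.

Lemma apart_allrel (R : realType) (z y : seq ((R * R) * nat)) :
  {in z & y, forall p q, [\/ p.1.2 < q.1.1, q.1.2 < p.1.1 | p.2 <> q.2]} ->
  allrel (@compatible R) z y.
Proof.
move=> sep; apply/allrelP => p q pz qy; apply/implyP => /andP[pq qp].
case: (sep p q pz qy) => [lt|lt|/eqP //].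
  by move: qp; rewrite leNgt lt.
by move: pq; rewrite leNgt lt.
Qed.

Lemma uniq_cat_disjoint (s1 s2 : seq nat) :
  uniq s1 -> uniq s2 -> {in s2, forall c, c \notin s1} -> uniq (s1 ++ s2).
Proof. by move=> u1 u2 d; rewrite cat_uniq u1 u2 andbT; apply/hasPn. Qed.

Lemma unzip1_nseq (R : realType) (z : seq ((R * R) * nat)) n J :
  unzip1 z = nseq n J -> {in z, forall p, p.1 = J} /\ size (unzip2 z) = n.
Proof.
move=> ez; split=> [p pz|]; last first.
  by rewrite size_map -(size_map fst) -/(unzip1 z) ez size_nseq.
by have := map_f fst pz; rewrite -/(unzip1 z) ez mem_nseq => /andP[_ /eqP].
Qed.

(** * Separation by bisection *)

(** A clique whose intervals depend on one real parameter is described by its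
parameters, paired with colors. *)
Definition place (R : realType) (g : R -> R * R) (w : seq (R * nat)) :=
  [seq (g p.1, p.2) | p <- w].

(** No parameter equals the threshold t, so a later interval that ends where the
parameter t would put the end of the clique meets the front and misses the
back. *)
Definition separates (R : realType) (lo hi t : R) (P : pred nat)
    (w : seq (R * nat)) : Prop :=
  {in w, forall p, [/\ lo < p.1 < hi, p.1 != t & P p.2 = (p.1 < t)]}.

(** The next parameter is always the midpoint of the current window: after a
color in P the rest is placed above it, and after another color below it, so
the parameters of the front stay below the window and those of the back above.
The adversary stops when the front has n elements or the back has n' elements,
whichever happens first. *)
Lemma separation (R : realType) (A : seq (R * R) -> nat) (g : R -> R * R)
    (P : pred nat) n n' h (lo hi : R) : lo < hi ->
  exists (w : seq (R * nat)) (t : R),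
    [/\ unzip2 w = replies A h (unzip1 (place g w)),
        lo < t < hi, separates lo hi t P w,
        (count P (unzip2 w) <= n)%N /\ (count (predC P) (unzip2 w) <= n')%N
      & count P (unzip2 w) = n \/ count (predC P) (unzip2 w) = n'].
Proof.
have [k] := ubnP (n + n'); elim: k => // k IHk in n n' h lo hi *.
move=> ltk lohi; pose x := (lo + hi) / 2.
have [lox xhi] : lo < x /\ x < hi by rewrite /x; split; lra.
have [n0|n_gt0] := boolP ((n == 0) || (n' == 0))%N.
  exists [::], x; split=> //=; first by rewrite lox.
  by case/orP: n0 => /eqP ->; [left|right].
case: n n' => [|n] [|n'] // in ltk n_gt0 *.
have [Pc|nPc] := boolP (P (A (rcons h (g x)))).
- have [||w [t [e /andP[xt thi] bw [c1 c2] c3]]] :=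
    IHk n n'.+1 (rcons h (g x)) x hi; [lia|done|].
  exists ((x, A (rcons h (g x))) :: w), t; split.
  + by rewrite /= e.
  + by rewrite (lt_trans lox xt).
  + move=> p; rewrite inE => /predU1P[->|/bw[/andP[xp ->] -> ->]] /=.
      by rewrite Pc lox xhi xt lt_eqF.
    by rewrite (lt_trans lox xp).
  + by rewrite /= Pc /= !add0n !add1n ltnS.
  + by rewrite /= Pc /= !add0n !add1n; case: c3 => ->; [left|right].
- have [||w [t [e /andP[lot tx] bw [c1 c2] c3]]] :=
    IHk n.+1 n' (rcons h (g x)) lo x; [lia|done|].
  exists ((x, A (rcons h (g x))) :: w), t; split.
  + by rewrite /= e.
  + by rewrite (lt_trans tx xhi) andbT.
  + move=> p; rewrite inE => /predU1P[->|/bw[/andP[-> px] -> ->]] /=.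
      by rewrite (negbTE nPc) lox xhi gt_eqF // lt_gtF.
    by rewrite (lt_trans px xhi).
  + by rewrite /= nPc (negbTE nPc) /= !add0n !add1n ltnS.
  + rewrite /= nPc (negbTE nPc) /= !add0n !add1n.
    by case: c3 => ->; [left|right].
Qed.

Lemma unzip1_place (R : realType) (g : R -> R * R) w :
  unzip1 (place g w) = map g (unzip1 w).
Proof. by rewrite /unzip1 -!map_comp. Qed.

Lemma unzip2_place (R : realType) (g : R -> R * R) w :
  unzip2 (place g w) = unzip2 w.
Proof. by rewrite /unzip2 -map_comp. Qed.

Lemma count_below (R : realType) (lo hi t : R) P w : separates lo hi t P w ->
  count (< t) (unzip1 w) = count P (unzip2 w).
Proof.
by move=> sw; rewrite !count_map; apply: eq_in_count => p /sw[_ _ /= ->].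
Qed.

Lemma count_above (R : realType) (lo hi t : R) P w : separates lo hi t P w ->
  count (predC (< t)) (unzip1 w) = count (predC P) (unzip2 w).
Proof.
by move=> sw; rewrite !count_map; apply: eq_in_count => p /sw[_ _ /= ->].
Qed.

Lemma separates_params (R : realType) (lo hi t : R) P w :
  separates lo hi t P w -> {in unzip1 w, forall s, lo < s < hi /\ s != t}.
Proof. by move=> sw _ /mapP[p /sw[p1 pt _] ->]. Qed.

Lemma front_placed (R : realType) (g : R -> R * R) (lo hi t : R) P w c :
  separates lo hi t P w -> c \in [seq c <- unzip2 w | P c] ->
  exists2 s, (g s, c) \in place g w & (lo < s < hi) && (s < t).
Proof.
move=> sw; rewrite mem_filter => /andP[Pc /mapP[p pw ep]].
have [p1 _ Pp] := sw p pw; exists p.1; last by rewrite p1 -Pp -ep Pc.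
by apply/mapP; exists p; rewrite // ep.
Qed.

Lemma placed (R : realType) (g : R -> R * R) (lo hi t : R) P w p :
  separates lo hi t P w -> p \in place g w ->
  exists2 s, p.1 = g s & lo < s < hi.
Proof.
by move=> sw /mapP[q /sw[q1 _ _] ->]; exists q.1.
Qed.

Lemma all_placed (R : realType) (sigma : R) (g : R -> R * R) (lo hi t : R) P w :
  separates lo hi t P w ->
  (forall s, lo < s < hi -> admissible sigma (g s)) ->
  all (admissible sigma) (unzip1 (place g w)).
Proof.
move=> sw admg; rewrite unzip1_place.
apply/allP => _ /mapP[_ /mapP[p pw ->] ->].
by have [/admg] := sw p pw.
Qed.

Lemma placed_uniq (R : realType) (g : R -> R * R) (lo hi t : R) P w :
  separates lo hi t P w -> pairwise (@compatible R) (place g w) ->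
  (forall s s', lo < s < hi -> lo < s' < hi -> overlap (g s) (g s')) ->
  uniq (unzip2 w).
Proof.
move=> sw cw ov; rewrite -(unzip2_place g); apply: clique_uniq cw _.
by move=> p q /(placed sw)[s -> s1] /(placed sw)[s' -> s1']; apply: ov.
Qed.

(** * Geometry of the construction *)

Definition long_core (R : realType) (e : R) : R * R := (0, 1 + e).

Definition short_core (R : realType) : R * R := (0, 1).

(** In the three cliques placed by separation, an interval with a smaller
parameter reaches further towards the intervals that have to meet the front. *)
Definition left_at (R : realType) (s : R) : R * R := (- s - 1, - s).

Definition right_at (R : realType) (e s : R) : R * R := (2 + e + s, 3 + e + s).

(** The right end is the threshold r of the right clique, so that every linking
interval meets its front but not its back; in [final_at], both ends are
thresholds, for the same reason. *)
Definition link_at (R : realType) (e r s : R) : R * R := (1 + s, 2 + e + r).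

Definition final_at (R : realType) (l f : R) : R * R := (- l, 1 + f).

Lemma construction_admissible (R : realType) (sigma e : R) :
  0 < e -> e <= 1 -> 1 + 2 * e <= sigma ->
  [/\ admissible sigma (long_core e), admissible sigma (short_core R),
      forall s, admissible sigma (left_at s),
      forall s, admissible sigma (right_at e s)
    & (forall r s, 0 < r < e -> 0 < s < e ->
         admissible sigma (link_at e r s)) /\
      (forall l f, 0 < l < e -> 0 < f < e ->
         admissible sigma (final_at l f))].
Proof.
move=> e0 e1 es; rewrite /admissible /=; split.
- by apply/andP; split; lra.
- by apply/andP; split; lra.
- by move=> s; apply/andP; split; lra.
- by move=> s; apply/andP; split; lra.
- split=> r s /andP[r0 re] /andP[s0 se]; apply/andP; split; lra.
Qed.

Lemma cliques_overlap (R : realType) (e : R) : 0 < e -> e <= 1 ->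
  [/\ forall s s', 0 < s < e -> 0 < s' < e -> overlap (left_at s) (left_at s'),
      forall s s', 0 < s < e -> 0 < s' < e ->
        overlap (right_at e s) (right_at e s')
    & forall r s s', 0 < r < e -> 0 < s < e -> 0 < s' < e ->
      [/\ overlap (link_at e r s) (link_at e r s'),
          overlap (long_core e) (link_at e r s)
        & s' < r -> overlap (right_at e s') (link_at e r s)]].
Proof.
move=> e0 e1; rewrite /overlap /=; split.
- by move=> s s' /andP[s0 se] /andP[s0' se']; apply/andP; split; lra.
- by move=> s s' /andP[s0 se] /andP[s0' se']; apply/andP; split; lra.
- move=> r s s' /andP[r0 re] /andP[s0 se] /andP[s0' se'].
  by split=> [||sr]; apply/andP; split; lra.
Qed.

Lemma final_overlaps (R : realType) (e l f : R) : 0 < l -> 0 < f -> 0 < e ->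
  [/\ overlap (final_at l f) (final_at l f),
      overlap (long_core e) (final_at l f),
      overlap (short_core R) (final_at l f),
      forall s, 0 < s -> s < l -> overlap (left_at s) (final_at l f)
    & forall r s, 0 < r -> s < f -> overlap (link_at e r s) (final_at l f)].
Proof.
move=> l0 f0 e0; rewrite /overlap /=; split.
- by apply/andP; split; lra.
- by apply/andP; split; lra.
- by apply/andP; split; lra.
- by move=> s s0 sl; apply/andP; split; lra.
- by move=> r s r0 sf; apply/andP; split; lra.
Qed.

(** * The offline coloring *)

(** Members of one clique just need different labels, so they can be taken
greedily: from a in the front, from b in the back. *)
Lemma label_sides (R : realType) (t : R) (a b : seq nat) (s : seq R) :
  uniq (a ++ b) -> (count (< t) s <= size a)%N ->
  (count (predC (< t)) s <= size b)%N ->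
  exists w : seq (R * nat),
    [/\ unzip1 w = s, uniq (unzip2 w)
      & {in w, forall p, p.2 \in if p.1 < t then a else b}].
Proof.
elim: s a b => [|x s IHs] a b; first by exists [::].
have fresh (w : seq (R * nat)) (a' b' : seq nat) l :
    l \notin a' -> l \notin b' ->
    {in w, forall p, p.2 \in if p.1 < t then a' else b'} -> l \notin unzip2 w.
  move=> la lb inw; apply/mapP => -[p /inw pab e]; move: pab la lb.
  by rewrite -e; case: ifP => _ ->.
rewrite /=; case xt: (x < t); rewrite /= ?add0n ?add1n.
- case: a => [|l a] //= /andP[].
  rewrite mem_cat negb_or => /andP[la lb] u ca cb.
  have [w [e uw inw]] := IHs a b u ca cb.
  have nw := fresh _ _ _ _ la lb inw.
  exists ((x, l) :: w); split; [by rewrite /= e|by rewrite /= nw|].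
  move=> p; rewrite inE => /predU1P[->|/inw] /=; first by rewrite xt mem_head.
  by case: ifP; rewrite ?inE => _ ->; rewrite ?orbT.
- case: b => [|l b] //=; rewrite uniq_catC /= => /andP[].
  rewrite mem_cat negb_or => /andP[lb la] u ca cb.
  have [|w [e uw inw]] := IHs a b _ ca cb; first by rewrite uniq_catC.
  have nw := fresh _ _ _ _ la lb inw.
  exists ((x, l) :: w); split; [by rewrite /= e|by rewrite /= nw|].
  move=> p; rewrite inE => /predU1P[->|/inw] /=; first by rewrite xt mem_head.
  by case: ifP; rewrite ?inE => _ ->; rewrite ?orbT.
Qed.

Lemma labelled_side (R : realType) (g : R -> R * R) (e t : R) (a b : seq nat)
    (s : seq R) :
  {in s, forall x, 0 < x < e /\ x != t} -> uniq (a ++ b) ->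
  (count (< t) s <= size a)%N -> (count (predC (< t)) s <= size b)%N ->
  exists z : seq ((R * R) * nat),
    [/\ unzip1 z = map g s, pairwise (@compatible R) z
      & {in z, forall p, exists x, p.1 = g x /\ 0 < x < e /\
          (x < t /\ p.2 \in a \/ t < x /\ p.2 \in b)}].
Proof.
move=> ins uab ca cb; have [w [ew uw inw]] := label_sides uab ca cb.
exists (place g w); split.
- by rewrite -ew /unzip1 -!map_comp.
- by apply: uniq_compatible; rewrite /unzip2 -map_comp.
- move=> _ /mapP[[x l] xlw ->] /=; have := inw _ xlw.
  have /ins[xe xt] : x \in s by rewrite -ew (map_f fst xlw).
  move=> lab; exists x; split=> //; split=> //; move: xt lab => /=.
  by case: ltgtP => //= _ _; [left|right].
Qed.

(** Each pair of cliques is either apart on the line or uses disjoint labels;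
the hypotheses record, for each clique, just the ends and labels needed for
that. *)
Lemma layout_compatible (R : realType) (m : nat) (e tL tK tF : R)
    (zX zS zL zK zF zJ : seq ((R * R) * nat)) :
  0 < tL -> 0 < tK -> 0 < tF -> tF < e ->
  {in zX, forall p, [/\ 0 <= p.1.1, p.1.2 = 1 + e,
    (3 * m <= p.2)%N & (p.2 < 4 * m)%N]} ->
  {in zS, forall p, [/\ 0 <= p.1.1, p.1.2 <= 1 & (4 * m <= p.2)%N]} ->
  {in zL, forall p, p.1.2 < 0 /\ (p.1.2 < - tL \/ (3 * m <= p.2)%N)} ->
  {in zK, forall p, 2 + e < p.1.1 /\
    (2 + e + tK < p.1.1 \/ (3 * m <= p.2)%N /\ (p.2 < 4 * m)%N)} ->
  {in zF, forall p, [/\ 1 < p.1.1, p.1.2 = 2 + e + tK &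
    (4 * m <= p.2)%N \/ 1 + tF < p.1.1 /\ (p.2 < 3 * m)%N]} ->
  {in zJ, forall p, [/\ p.1.1 = - tL, p.1.2 = 1 + tF & (p.2 < 3 * m)%N]} ->
  all (pairwise (@compatible R)) [:: zX; zS; zL; zK; zF; zJ] ->
  pairwise (@compatible R) (((((zX ++ zS) ++ zL) ++ zK) ++ zF) ++ zJ).
Proof.
move=> tL0 tK0 tF0 tFe hX hS hL hK hF hJ /= /andP[pX /andP[pS /andP[pL]]].
move=> /andP[pK /andP[pF /andP[pJ _]]].
have m34 : (3 * m <= 4 * m)%N by rewrite leq_mul2r orbT.
have neq a b l l' : (a <= b)%N -> (l < a)%N -> (b <= l')%N -> l <> l'.
  move=> ab la bl e'.
  by move: (leq_trans la (leq_trans ab bl)); rewrite e' ltnn.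
have neq' a b l l' : (a <= b)%N -> (l < a)%N -> (b <= l')%N -> l' <> l.
  by move=> ab la bl /esym; apply: neq ab la bl.
rewrite !pairwise_cat !allrel_catl pX pS pL pK pF pJ !andbT.
have -> : allrel (@compatible R) zX zS.
  apply: apart_allrel => p q /hX[_ _ _ lp] /hS[_ _ lq].
  by apply: Or33; apply: neq lp lq.
have -> : allrel (@compatible R) zX zL.
  by apply: apart_allrel => p q /hX[p0 _ _ _] /hL[q0 _]; apply: Or32; lra.
have -> : allrel (@compatible R) zX zK.
  by apply: apart_allrel => p q /hX[_ p1 _ _] /hK[q2 _]; apply: Or31; lra.
have -> : allrel (@compatible R) zX zF.
  apply: apart_allrel => p q /hX[_ _ lp lp'] /hF[_ _ [lq|[_ lq]]]; apply: Or33.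
    exact: neq lp' lq.
  exact: neq' lq lp.
have -> : allrel (@compatible R) zX zJ.
  apply: apart_allrel => p q /hX[_ _ lp _] /hJ[_ _ lq].
  by apply: Or33; apply: neq' lq lp.
have -> : allrel (@compatible R) zS zL.
  by apply: apart_allrel => p q /hS[p0 _ _] /hL[q0 _]; apply: Or32; lra.
have -> : allrel (@compatible R) zS zK.
  by apply: apart_allrel => p q /hS[_ p1 _] /hK[q2 _]; apply: Or31; lra.
have -> : allrel (@compatible R) zS zF.
  by apply: apart_allrel => p q /hS[_ p1 _] /hF[q1 _ _]; apply: Or31; lra.
have -> : allrel (@compatible R) zS zJ.
  apply: apart_allrel => p q /hS[_ _ lp] /hJ[_ _ lq].
  by apply: Or33; apply: neq' lq lp.
have -> : allrel (@compatible R) zL zK.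
  by apply: apart_allrel => p q /hL[p0 _] /hK[q2 _]; apply: Or31; lra.
have -> : allrel (@compatible R) zL zF.
  by apply: apart_allrel => p q /hL[p0 _] /hF[q1 _ _]; apply: Or31; lra.
have -> : allrel (@compatible R) zL zJ.
  apply: apart_allrel => p q /hL[_ [pt|lp]] /hJ[qt _ lq].
    by apply: Or31; rewrite qt.
  by apply: Or33; apply: neq' lq lp.
have -> : allrel (@compatible R) zK zF.
  apply: apart_allrel => p q /hK[_ [pt|[lp lp']]] /hF[_ qt lq].
    by apply: Or32; rewrite qt.
  apply: Or33; case: lq => [lq|[_ lq]]; first exact: neq lp' lq.
  exact: neq' lq lp.
have -> : allrel (@compatible R) zK zJ.
  by apply: apart_allrel => p q /hK[p2 _] /hJ[_ q1 _]; apply: Or32; lra.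
have -> // : allrel (@compatible R) zF zJ.
apply: apart_allrel => p q /hF[_ _ [lp|[pt _]]] /hJ[_ qt lq].
  by apply: Or33; apply: neq' lq lp.
by apply: Or32; rewrite qt.
Qed.

Lemma uniq_labels (m : nat) :
  [/\ uniq (iota (3 * m) (3 * m) ++ iota 0 (3 * m)),
      uniq (iota (3 * m) m ++ (iota 0 (3 * m) ++ iota (4 * m) (2 * m)))
    & uniq (iota (4 * m) m ++ (iota 0 (3 * m) ++ iota (5 * m) m))].
Proof.
split; rewrite !cat_uniq !iota_uniq /= ?andbT.
- by apply/hasPn => c; rewrite !mem_iota; lia.
- apply/andP; split; apply/hasPn => c; rewrite ?mem_cat !mem_iota; lia.
- apply/andP; split; apply/hasPn => c; rewrite ?mem_cat !mem_iota; lia.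
Qed.

(** Sizes are only bounded from above, so that the statement also covers the
construction when it stops after the right clique: then sF is empty and j is
0. *)
Lemma layout (R : realType) (m j : nat) (e tL tK tF : R) (sL sK sF : seq R) :
  0 < tL -> 0 < tK -> 0 < tF -> tF < e ->
  {in sL, forall s, 0 < s < e /\ s != tL} ->
  {in sK, forall s, 0 < s < e /\ s != tK} ->
  {in sF, forall s, 0 < s < e /\ s != tF} ->
  (count (< tL) sL <= 3 * m)%N -> (count (predC (< tL)) sL <= 3 * m)%N ->
  (count (< tK) sK <= m)%N -> (count (predC (< tK)) sK <= 5 * m)%N ->
  (count (< tF) sF <= m)%N -> (count (predC (< tF)) sF <= 4 * m)%N ->
  (j <= 3 * m)%N ->
  exists z, [/\ unzip1 z =
      ((((nseq m (long_core e) ++ nseq (2 * m) (short_core R))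
        ++ map (@left_at R) sL) ++ map (right_at e) sK)
        ++ map (link_at e tK) sF) ++ nseq j (final_at tL tF),
    pairwise (@compatible R) z & all (fun p => p.2 < 6 * m)%N z].
Proof.
move=> tL0 tK0 tF0 tFe inL inK inF cL cL' cK cK' cF cF' ltj.
have [uL uK uF] := uniq_labels m.
have m6 : (3 * m + 3 * m = 6 * m /\ 4 * m + 2 * m = 6 * m)%N by clear; lia.
have [|| zL [eL cptL hL]] := @labelled_side R (@left_at R) e tL _ _ sL inL uL.
  by rewrite size_iota.
  by rewrite size_iota.
have [|| zK [eK cptK hK]] := @labelled_side R (right_at e) e tK _ _ sK inK uK.
  by rewrite size_iota.
  by rewrite size_cat !size_iota -mulnDl.
have [|| zF [eF cptF hF]] := @labelled_side R (link_at e tK) e tF _ _ sF inF uF.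
  by rewrite size_iota.
  by rewrite size_cat !size_iota -mulSnr.
pose zX := [seq (long_core e, l) | l <- iota (3 * m) m].
pose zS := [seq (short_core R, l) | l <- iota (4 * m) (2 * m)].
pose zJ := [seq (final_at tL tF, l) | l <- iota 0 j].
exists (((((zX ++ zS) ++ zL) ++ zK) ++ zF) ++ zJ); split.
- rewrite /unzip1 !map_cat -!/(unzip1 _) eL eK eF /unzip1 -!map_comp.
  have const (I : R * R) a n :
      map (fst \o pair I : nat -> R * R) (iota a n) = nseq n I.
    by elim: n a => //= n IHn a; rewrite IHn.
  by rewrite !const.
- apply: (@layout_compatible R m e tL tK tF) => //.
  + by move=> _ /mapP[l + ->]; rewrite mem_iota -mulSnr => /andP[].
  + by move=> _ /mapP[l + ->]; rewrite mem_iota => /andP[].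
  + move=> [I l] /hL[x [-> [/andP[x0 _]]]] /=; rewrite !mem_iota => labx.
    split; first by lra.
    by case: labx => -[xt /andP[lx _]]; [right|left; rewrite ltrN2].
  + move=> [I l] /hK[x [-> [/andP[x0 _]]]] /=; rewrite !mem_iota => labx.
    split; first by lra.
    case: labx => -[xt lx]; last by left; rewrite ltrD2l.
    by right; move: lx; rewrite -mulSnr => /andP[].
  + move=> [I l] /hF[x [-> [/andP[x0 _]]]] /=.
    rewrite mem_cat !mem_iota => labx.
    split=> //; first by lra.
    case: labx => [[_ /andP[]]|[xt /orP[lx|/andP[lx _]]]]; first by left.
      by right; rewrite ltrD2l.
    by left; apply: leq_trans lx; rewrite leq_mul2r orbT.
  + move=> _ /mapP[l + ->]; rewrite mem_iota /= add0n => lj.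
    by split=> //; apply: leq_trans lj ltj.
  + rewrite /= cptL cptK cptF !uniq_compatible //;
      rewrite /unzip2 -map_comp map_id_in ?iota_uniq //.
- rewrite !all_cat -!andbA; apply/and5P; split; last (apply/andP; split);
    apply/allP.
  + by move=> _ /mapP[l + ->]; rewrite mem_iota /=; clear; lia.
  + by move=> _ /mapP[l + ->]; rewrite mem_iota /=; clear; lia.
  + by move=> [I l] /hL[x [_ [_ [[_]|[_]]]]] /=; rewrite mem_iota; clear; lia.
  + move=> [I l] /hK[x [_ [_ [[_]|[_]]]]] /=;
      by rewrite ?mem_cat !mem_iota; clear; lia.
  + move=> [I l] /hF[x [_ [_ [[_]|[_]]]]] /=;
      by rewrite ?mem_cat !mem_iota; clear; lia.
  + by move=> _ /mapP[l + ->]; rewrite mem_iota /=; move: ltj; clear; lia.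
Qed.

(** * The adversary *)

(** The letters X and S stand for the long and the short core intervals, L, K, F
and J for the left, right, linking and final cliques; LF, KF and FN are the
colors of the fronts of L, K and F, KB and FB those of the backs of K and F.
The final count is 6m colors in W, m in FN and 3m for J. *)
Lemma forcing (R : realType) (sigma : R) A (m : nat) :
  1 < sigma -> online_algorithm sigma A ->
  exists s, [/\ all (admissible sigma) s, colorable (6 * m) s
              & (10 * m <= colors_used A s)%N].
Proof.
move=> sigma1 onA.
(* Up to e = 1, two intervals of the same clique overlap whatever their
   parameters are. *)
have [e [e0 e1 es]] : exists e, [/\ 0 < e, e <= 1 & 1 + 2 * e <= sigma].
  have [?|?] := leP sigma 3; first by exists ((sigma - 1) / 2); split; lra.
  by exists 1; split; lra.
have [aX aS aL aK [aF aJ]] := construction_admissible e0 e1 es.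
have [oL oK oF] := cliques_overlap e0 e1.
have [zX [eX rX]] := present A [::] (nseq m (long_core e)).
have [zS [eS rS]] := present A (unzip1 zX) (nseq (2 * m) (short_core R)).
have [fX sX] := unzip1_nseq eX; have [fS sS] := unzip1_nseq eS.
pose zM := zX ++ zS; pose cM := unzip2 zM.
have tM : transcript A zM by apply: transcript_cat.
have admM : all (admissible sigma) (unzip1 zM).
  by rewrite /unzip1 map_cat all_cat -!/(unzip1 _) eX eS !all_nseq aX aS !orbT.
have uM : uniq cM.
  apply: clique_uniq (transcript_compatible onA admM tM) _.
  have inM p : p \in zM -> p.1.1 <= 0 /\ 0 <= p.1.2.
    by rewrite mem_cat => /orP[/fX|/fS] -> /=; split=> //; lra.
  move=> p q /inM[p1 p2] /inM[q1 q2].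
  by rewrite /overlap (le_trans p1 q2) (le_trans q1 p2).
have szM : size cM = (3 * m)%N.
  by rewrite /cM /unzip2 map_cat size_cat -!/(unzip2 _) sX sS -mulSn.
(* At most 3m intervals of the clique can get core colors, so the bound 3m + 1
   on the back is never reached and the front gets its 3m elements. *)
pose PL c := c \notin cM.
have [wL [tL [rL /[dup] tLe /andP[tL0 _] sepL [cL cL'] fL]]] :=
  separation A (@left_at R) PL (3 * m) (3 * m).+1 (unzip1 zM) e0.
pose zL := place (@left_at R) wL; pose LF := [seq c <- unzip2 wL | PL c].
have tML : transcript A (zM ++ zL).
  by apply: transcript_cat => //; rewrite unzip2_place.
have admL : all (admissible sigma) (unzip1 (zM ++ zL)).
  rewrite /unzip1 map_cat all_cat -!/(unzip1 _) admM /=.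
  exact: all_placed sepL _.
have uL : uniq (unzip2 wL).
  have := transcript_compatible onA admL tML.
  rewrite pairwise_cat => /and3P[_ _ cp]; exact: placed_uniq sepL cp oL.
have leL' : (count (predC PL) (unzip2 wL) <= 3 * m)%N.
  rewrite -size_filter -szM; apply: uniq_leq_size; first exact: filter_uniq.
  by move=> c; rewrite mem_filter /= negbK => /andP[].
have szLF : size LF = (3 * m)%N.
  by rewrite size_filter; case: fL => // fL'; move: leL'; rewrite fL' ltnn.
have uLF : uniq LF by apply: filter_uniq.
have LFM : {in LF, forall c, c \notin cM}.
  by move=> c; rewrite mem_filter => /andP[].
pose B := unzip2 zS ++ LF; pose PK c := c \in B.
have szB : size B = (5 * m)%N by rewrite size_cat sS szLF -mulnDl.
have uB : uniq B.
  apply: uniq_cat_disjoint => //.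
    by move: uM; rewrite /cM /unzip2 map_cat cat_uniq => /and3P[].
  move=> c /LFM; apply: contra; rewrite /cM /unzip2 map_cat mem_cat => ->.
  by rewrite orbT.
have [wK [tK [rK /[dup] tKe /andP[tK0 _] sepK [cK cK'] fK]]] :=
  separation A (right_at e) PK m (5 * m) (unzip1 (zM ++ zL)) e0.
pose zK := place (right_at e) wK; pose KF := [seq c <- unzip2 wK | PK c].
pose KB := [seq c <- unzip2 wK | predC PK c].
have tMLK : transcript A ((zM ++ zL) ++ zK).
  by apply: transcript_cat => //; rewrite unzip2_place.
have admK : all (admissible sigma) (unzip1 ((zM ++ zL) ++ zK)).
  rewrite /unzip1 map_cat all_cat -!/(unzip1 _) admL /=.
  exact: all_placed sepK _.
have uK : uniq (unzip2 wK).
  have := transcript_compatible onA admK tMLK.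
  rewrite pairwise_cat => /and3P[_ _ cp]; exact: placed_uniq sepK cp oK.
have unz1M : unzip1 zM = nseq m (long_core e) ++ nseq (2 * m) (short_core R).
  by rewrite /unzip1 map_cat -!/(unzip1 _) eX eS.
(* The coloring serves both ends of the construction, with or without the
   linking and the final cliques. *)
have finish j tF wF PF : 0 < tF < e -> separates 0 e tF PF wF ->
    (count PF (unzip2 wF) <= m)%N ->
    (count (predC PF) (unzip2 wF) <= 4 * m)%N ->
    (j <= 3 * m)%N ->
    let s := unzip1 ((zM ++ zL) ++ zK) ++ map (link_at e tK) (unzip1 wF)
      ++ nseq j (final_at tL tF) in
    all (admissible sigma) s /\ colorable (6 * m) s.
  move=> tFe sepF cF cF' lej s; have /andP[tF0 tFe'] := tFe.
  have adm : all (admissible sigma) s.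
    rewrite !all_cat admK all_nseq aJ // orbT andbT -unzip1_place.
    by apply: all_placed sepF _ => r; apply: aF.
  split=> //.
  have [||||||| z [ez cz lz]] := @layout R m j e tL tK tF (unzip1 wL)
    (unzip1 wK) (unzip1 wF) tL0 tK0 tF0 tFe' (separates_params sepL)
    (separates_params sepK) (separates_params sepF);
    rewrite ?(count_below sepL) ?(count_above sepL) ?(count_below sepK)
      ?(count_above sepK) ?(count_below sepF) ?(count_above sepF) //.
  have es' : s = unzip1 z.
    rewrite ez /s /unzip1 !map_cat -!/(unzip1 _) -unz1M /unzip1 map_cat.
    by rewrite -!/(unzip1 _) !unzip1_place -!catA.
  by rewrite es' in adm *; apply: (compatible_colorable adm).
have [fK'|fK'] : count (predC PK) (unzip2 wK) = (5 * m)%N \/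
    count PK (unzip2 wK) = m by case: fK; [right|left].
  exists (unzip1 ((zM ++ zL) ++ zK)).
  have [|||| a c] := finish 0%N tK [::] PK tKe => //.
  rewrite /= !cats0 in a c; split=> //.
  have <- : size (B ++ KB) = (10 * m)%N.
    by rewrite size_cat szB size_filter fK' -mulnDl.
  apply: colors_used_ge => //.
    apply: uniq_cat_disjoint => //; first exact: filter_uniq.
    by move=> c'; rewrite mem_filter => /andP[].
  move=> c'; rewrite /unzip2 !map_cat !mem_cat -!/(unzip2 _) !unzip2_place.
  rewrite !mem_filter.
  by case/orP => [/orP[->|/andP[_ ->]]|/andP[_ ->]]; rewrite ?orbT.
(* The linking intervals see the m long core colors and the m colors of KF, all
   in W, so their back has at most 4m elements and the bound 4m + 1 is never
   reached. *)
pose W := cM ++ LF; pose PF c := c \notin W.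
have [wF [tF [rF /[dup] tFe /andP[tF0 _] sepF [cF cF'] fF]]] :=
  separation A (link_at e tK) PF m (4 * m).+1 (unzip1 ((zM ++ zL) ++ zK)) e0.
pose zF := place (link_at e tK) wF; pose FN := [seq c <- unzip2 wF | PF c].
pose FB := [seq c <- unzip2 wF | predC PF c].
have tF' : transcript A (((zM ++ zL) ++ zK) ++ zF).
  by apply: transcript_cat => //; rewrite unzip2_place.
have [zJ [eJ rJ]] := present A (unzip1 (((zM ++ zL) ++ zK) ++ zF))
  (nseq (3 * m) (final_at tL tF)).
have [fJ sJ] := unzip1_nseq eJ.
have tJ : transcript A ((((zM ++ zL) ++ zK) ++ zF) ++ zJ).
  exact: transcript_cat.
have admJ : all (admissible sigma) (unzip1 ((((zM ++ zL) ++ zK) ++ zF) ++ zJ)).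
  rewrite /unzip1 2!map_cat 2!all_cat -!/(unzip1 _) admK eJ all_nseq aJ // orbT.
  rewrite andbT; apply: all_placed sepF _ => r; exact: aF.
have cptJ := transcript_compatible onA admJ tJ.
have [cptF pJ] : pairwise (@compatible R) (((zM ++ zL) ++ zK) ++ zF) /\
    pairwise (@compatible R) zJ.
  by move: cptJ; rewrite pairwise_cat => /and3P[_].
have uF : uniq (unzip2 wF).
  move: cptF; rewrite pairwise_cat => /and3P[_ _ pF].
  apply: placed_uniq sepF pF _ => r s r1 s1.
  by have [] := oF tK r s tKe r1 s1.
have FBB : {in FB, forall c, c \in B /\ c \notin KF}.
  move=> c; rewrite mem_filter /= negbK => /andP[cW].
  rewrite -(unzip2_place (link_at e tK)) => /mapP[q qF ec].
  have [s qs s1] := placed sepF qF.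
  have [_ oX oKF] := oF tK s s tKe s1 s1.
  split; last first.
    apply/negP => /(front_placed (right_at e) sepK)[x xK /andP[x1 xt]].
    have [_ _ /(_ xt) oxq] := oF tK s x tKe s1 x1; rewrite -qs in oxq.
    apply: (@compatible_neq _ _ _ (right_at e x, c) q cptF _ qF oxq ec).
    by rewrite mem_cat [_ \in zK]xK orbT.
  have cX : c \notin unzip2 zX.
    apply/negP => /mapP[p pX ep]; rewrite -qs -(fX p pX) in oX.
    apply: (@compatible_neq _ _ _ p q cptF _ qF oX); last by rewrite -ep.
    by rewrite !mem_cat pX.
  move: cW; rewrite /W mem_cat /cM /unzip2 map_cat mem_cat -!/(unzip2 _).
  by rewrite (negbTE cX) /B mem_cat.
have leF' : (count (predC PF) (unzip2 wF) <= 4 * m)%N.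
  have szKF : size KF = m by rewrite size_filter.
  rewrite -(leq_add2r m) -size_filter -/FB -{1}szKF -size_cat -mulSnr -szB.
  apply: uniq_leq_size.
    apply: uniq_cat_disjoint; rewrite ?filter_uniq // => c cKF.
    by apply/negP => /FBB[_]; rewrite cKF.
  move=> c; rewrite mem_cat => /orP[/FBB[]|] //.
  by rewrite mem_filter => /andP[].
have szFN : size FN = m.
  by rewrite size_filter; case: fF => // fF'; move: leF'; rewrite fF' ltnn.
have [adm colo] := finish (3 * m)%N tF wF PF tFe sepF cF leF' (leqnn _).
exists (unzip1 ((((zM ++ zL) ++ zK) ++ zF) ++ zJ)).
have es' : unzip1 ((((zM ++ zL) ++ zK) ++ zF) ++ zJ) =
    unzip1 ((zM ++ zL) ++ zK) ++ map (link_at e tK) (unzip1 wF) ++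
      nseq (3 * m) (final_at tL tF).
  by rewrite /unzip1 2!map_cat -!/(unzip1 _) unzip1_place eJ -catA.
split; [by []|by rewrite es'|].
have <- : size (W ++ FN ++ unzip2 zJ) = (10 * m)%N.
  by rewrite !size_cat szM szLF szFN sJ; clear; lia.
have [oJ oXJ oSJ oLJ oFJ] := final_overlaps tL0 tF0 e0.
have newJ q : q \in zJ -> q.2 \notin W ++ FN.
  move=> qJ; rewrite !mem_cat !negb_or -andbA.
  have neqJ p : p \in ((zM ++ zL) ++ zK) ++ zF -> overlap p.1 q.1 ->
    p.2 = q.2 -> False by move=> pz; apply: compatible_neq cptJ pz qJ.
  apply/and3P; split; apply/negP.
  - move=> /mapP[p]; rewrite mem_cat => pM ep.
    apply: (neqJ p) (esym ep); first by rewrite !mem_cat pM.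
    by rewrite (fJ q qJ); case/orP: pM => [/fX|/fS] ->.
  - move=> /(front_placed (@left_at R) sepL)[s sL /andP[/andP[s0 _] st]].
    apply: (neqJ (left_at s, q.2)) => //; last by rewrite (fJ q qJ) oLJ.
    by rewrite !mem_cat [_ \in zL]sL !orbT.
  - move=> /(front_placed (link_at e tK) sepF)[s sF /andP[_ st]].
    apply: (neqJ (link_at e tK s, q.2)) => //; last by rewrite (fJ q qJ) oFJ.
    by rewrite mem_cat [_ \in zF]sF orbT.
apply: colors_used_ge => //.
- rewrite catA; apply: uniq_cat_disjoint; last by move=> _ /mapP[q /newJ + ->].
  + apply: uniq_cat_disjoint; first exact: uniq_cat_disjoint.
      exact: filter_uniq.
    by move=> c; rewrite mem_filter => /andP[].
  + by apply: clique_uniq pJ _ => p q /fJ -> /fJ ->.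
- move=> c; rewrite /W /cM /zM /unzip2 !map_cat !mem_cat -!/(unzip2 _).
  rewrite !unzip2_place !mem_filter.
  by case/orP => [/orP[/orP[]|/andP[_]]|/orP[/andP[_]|]] ->; rewrite ?orbT.
Qed.

Theorem theorem4 (R : realType) (sigma : R) (hsigma : 1 < sigma) :
  ~ exists (A : seq (R * R) -> nat) (alpha : R),
      [/\ online_algorithm sigma A, alpha < 5 / 3 & competitive sigma A alpha].
Proof.
move=> [A [alpha [onA alpha53]]]; rewrite /competitive limn_esup_lim.
apply/negP; rewrite -ltNge; apply: (@lt_le_trans _ _ (5 / 3)%:E).
  by rewrite lte_fin.
apply: lime_ge; first exact: is_cvg_esups.
apply: nearW => n.
pose chi := (6 * n.+1)%N.
have [s [adm col used]] := @forcing R sigma A n.+1 hsigma onA.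
apply: ereal_sup_ge; exists (worst_case_colors sigma A chi * (chi%:R^-1)%:E)%E.
  exists chi => //=; rewrite /chi; lia.
have chi0 : (0 : R) < chi%:R by rewrite ltr0n /chi.
rewrite lee_pdivlMr // -EFinM.
apply: ereal_sup_ge; exists (colors_used A s)%:R%:E; first by exists s.
rewrite lee_fin; apply: (@le_trans _ _ (10 * n.+1)%N%:R).
  by rewrite /chi !natrM; lra.
by rewrite ler_nat.
Qed.
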